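(* For each $i=1,\dots,m$, let $\{\tilde x_{i,k}\}$, $\{u_{i,k}\}$, $\{\varepsilon_{i,k}\}$ be generated by Algorithm 4 (the inexact operator splitting method for $T_1,\dots,T_m$ described in the context), and define $$\tilde x_{i,k}^a:=\frac1k\sum_{\ell=1}^k\tilde x_{i,\ell},\quad u_{i,k}^a:=\frac1k\sum_{\ell=1}^ku_{i,\ell},\quad \varepsilon_{i,k}^a:=\frac1k\sum_{\ell=1}^k\big[\varepsilon_{i,\ell}+\langle\tilde x_{i,\ell}-\tilde x_{i,k}^a,\,u_{i,\ell}-u_{i,k}^a\rangle\big].$$ Let $d_{0,\Sigma}$ denote the distance of $(x_0+y_{1,0},\dots,x_0+y_{m,0})$ to $\mathcal S^*(\Sigma)$. Then: (a) For any $k\ge1$ there exists $j\in\{1,\dots,k\}$ such that $$u_{i,j}\in T_i^{\varepsilon_{i,j}}(\tilde x_{i,j})\quad\forall i=1,\dots,m,$$ $$\Big\|\sum_{i=1}^mu_{i,j}\Big\|\le\frac{\sqrt m\,d_{0,\Sigma}}{\sqrt k}\sqrt{\frac{1+\sigma}{1-\sigma}},\qquad \|\tilde x_{i,j}-\tilde x_{\ell,j}\|\le\frac{2\,d_{0,\Sigma}}{\sqrt k}\sqrt{\frac{1+\sigma}{1-\sigma}}\quad\forall i,\ell=1,\dots,m,$$ $$\sum_{i=1}^m\varepsilon_{i,j}\le\frac{\sigma^2d_{0,\Sigma}^2}{2(1-\sigma^2)k}.$$ (b) For any $k\ge1$, $$u_{i,k}^a\in T_i^{\varepsilon_{i,k}^a}(\tilde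 x_{i,k}^a)\quad\forall i=1,\dots,m,$$ $$\Big\|\sum_{i=1}^mu_{i,k}^a\Big\|\le\frac{2\sqrt m\,d_{0,\Sigma}}{k},\qquad \|\tilde x_{i,k}^a-\tilde x_{\ell,k}^a\|\le\frac{4\,d_{0,\Sigma}}{k}\quad\forall i,\ell=1,\dots,m,$$ $$\sum_{i=1}^m\varepsilon_{i,k}^a\le\frac{2(1+\sigma/\sqrt{1-\sigma^2})\,d_{0,\Sigma}^2}{k}.$$
   Context: $\mathcal H$ is a real Hilbert space, $m\ge2$, and $T_i:\mathcal H\rightrightarrows\mathcal H$, $i=1,\dots,m$, are maximal monotone. $\mathcal H^m$ carries the inner product $\langle(x_i),(x_i')\rangle=\sum_{i=1}^m\langle x_i,x_i'\rangle$ and induced norm. For $\varepsilon\ge0$, $T_i^\varepsilon(x):=\{v\in\mathcal H:\langle v'-v,x'-x\rangle\ge-\varepsilon\ \ \forall (x',v')\text{ with }v'\in T_i(x')\}$. The problem is $0\in\sum_{i=1}^mT_i(x)$; its extended solution set, assumed nonempty, is $$\mathcal S^*(\Sigma):=\Big\{(z_i)_{i=1}^m\in\mathcal H^m:\ \exists\,x,u_1,\dots,u_m\in\mathcal H,\ u_i\in T_i(x)\ \forall i,\ \sum_{i=1}^mu_i=0,\ z_i=x+u_i\ \forall i\Big\}.$$ Algorithm 4: given $(x_0,y_{1,0},\dots,y_{m,0})\in\mathcal H^{m+1}$ with $y_{1,0}+\dots+y_{m,0}=0$ and $\sigma\in[0,1[$, for $k=1,2,\dots$: for each $i$ choose any $\tilde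 x_{i,k}\in\mathcal H$ and $\varepsilon_{i,k}\ge0$ such that $$u_{i,k}:=x_{k-1}+y_{i,k-1}-\tilde x_{i,k}\in T_i^{\varepsilon_{i,k}}(\tilde x_{i,k}),\qquad \varepsilon_{i,k}\le\frac{\sigma^2}{2}\|\tilde x_{i,k}-x_{k-1}\|^2,$$ and set $x_k=\frac1m\sum_{i=1}^m\tilde x_{i,k}$ and $y_{i,k}=u_{i,k}-\frac1m\sum_{\ell=1}^mu_{\ell,k}$ for $i=1,\dots,m$. *)

(* Defs.v *)
From mathcomp Require Import all_boot all_order all_algebra.
From mathcomp Require Import all_classical all_reals all_analysis.
Set Implicit Arguments.
Unset Strict Implicit.
Unset Printing Implicit Defensive.
Import Order.TTheory GRing.Theory Num.Theory.
Import numFieldNormedType.Exports.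
Local Open Scope classical_set_scope.
Local Open Scope ring_scope.

(* A real Hilbert space is a complete normed module [H] together with an inner
   product [ip : {dot H for idfun}] (bilinear, symmetric, positive definite)
   that induces the norm of [H]. *)
Definition induces_norm (R : realType) (H : completeNormedModType R)
    (ip : {dot H for idfun}) : Prop :=
  forall x : H, `|x| = Num.sqrt (ip x x).

Section HilbertSpace.
Context {R : realType} {H : completeNormedModType R}.
Variable ip : {dot H for idfun}.

(* A point-to-set operator is a map [T : H -> set H]; [T x v] reads "v is in
   T(x)". *)
Definition monotone (T : H -> set H) : Prop :=
  forall x v x' v' : H, T x v -> T x' v' -> 0 <= ip (v' - v) (x' - x).

Definition maximal_monotone (T : H -> set H) : Prop :=
  monotone T /\
  forall S : H -> set H,
    monotone S -> (forall x, T x `<=` S x) -> forall x, S x = T x.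

(* The enlargement is meant for [0 <= e], which is not required here: when [T] is
   maximal monotone and [e < 0] the set is empty, so that membership entails
   [0 <= e]. *)
Definition enlargement (T : H -> set H) (e : R) (x : H) : set H :=
  [set v | forall x' v' : H, T x' v' -> - e <= ip (v' - v) (x' - x)].

Definition prod_ip (m : nat) (z w : 'I_m -> H) : R := \sum_(i < m) ip (z i) (w i).

Definition prod_norm (m : nat) (z : 'I_m -> H) : R := Num.sqrt (prod_ip z z).

(* A real infimum, hence the junk value 0 when [S] is empty. *)
Definition prod_dist (m : nat) (z : 'I_m -> H) (S : set ('I_m -> H)) : R :=
  inf [set prod_norm (fun i => z i - w i) | w in S].

Definition extended_solution_set (m : nat) (T : 'I_m -> H -> set H) :
    set ('I_m -> H) :=
  [set z | exists (x : H) (u : 'I_m -> H),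
     [/\ forall i, T i x (u i), \sum_(i < m) u i = 0
       & forall i, z i = x + u i]].

(* [xt], [u] and [eps] are sequences indexed by k = 1, 2, ...: their values at
   k = 0 are unconstrained. *)
Record inexact_splitting (m : nat) (T : 'I_m -> H -> set H) (sigma : R)
    (x : nat -> H) (y xt u : 'I_m -> nat -> H) (eps : 'I_m -> nat -> R) : Prop :=
  InexactSplitting {
    splitting_y0 : \sum_(i < m) y i 0%N = 0;
    splitting_eps_ge0 : forall i k, 0 <= eps i k.+1;
    splitting_uE : forall i k, u i k.+1 = x k + y i k - xt i k.+1;
    splitting_incl : forall i k,
      enlargement (T i) (eps i k.+1) (xt i k.+1) (u i k.+1);
    splitting_error : forall i k,
      eps i k.+1 <= sigma ^+ 2 / 2 * `|xt i k.+1 - x k| ^+ 2;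
    splitting_xE : forall k, x k.+1 = m%:R^-1 *: \sum_(i < m) xt i k.+1;
    splitting_yE : forall i k,
      y i k.+1 = u i k.+1 - m%:R^-1 *: \sum_(l < m) u l k.+1
  }.

Definition ergodic_mean (f : nat -> H) (k : nat) : H :=
  k%:R^-1 *: \sum_(1 <= l < k.+1) f l.

Definition ergodic_error (xt u : nat -> H) (eps : nat -> R) (k : nat) : R :=
  k%:R^-1 * \sum_(1 <= l < k.+1)
    (eps l + ip (xt l - ergodic_mean xt k) (u l - ergodic_mean u k)).

End HilbertSpace.

(* Main.v *)
From HB Require Import structures.
Require Import Defs.
From mathcomp Require Import all_boot all_order all_algebra.
From mathcomp Require Import all_classical all_reals all_analysis.
From mathcomp Require Import ring lra.
Set Implicit Arguments.
Unset Strict Implicit.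
Unset Printing Implicit Defensive.
Import Order.TTheory GRing.Theory Num.Theory.
Import numFieldNormedType.Exports.
Local Open Scope classical_set_scope.
Local Open Scope ring_scope.

(** The method is the proximal point method in disguise. In [H ^ m], let [V] be
    the diagonal and [V^perp] the families with zero sum, and let
    [partial_inverse p q] be the projection of [p] on [V] plus that of [q] on
    [V^perp]. Swapping the [V^perp] components of [(xt, u)] turns the graph of
    [T 0 x ... x T (m - 1)] into that of its partial inverse in the sense of
    Spingarn, whose zeros are the extended solutions. If [z k] is the family
    [x k + y i k], the rules of the algorithm say that
    - [z k.+1 = partial_inverse xt u], by the definition of [x] and [y];
    - [z k - z k.+1 = partial_inverse u xt], because [z k = xt + u];
    - [2 * sum_i eps i <= sigma ^ 2 * |z k - z k.+1| ^ 2], because the sum of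
      the [|xt i - x k| ^ 2] is exactly [|z k - z k.+1| ^ 2].
    The swap preserves the pairing of its two outputs
    ([prod_ip_partial_inverse]), so the enlargement inclusions summed over [i]
    read [<z k - z k.+1, z k.+1 - w> >= - sum_i eps i] for every extended
    solution [w]. Thus [z] is an inexact proximal sequence with relative error
    and unit stepsize, and the usual Fejer argument gives
    [|z k - w| ^ 2 + (1 - sigma ^ 2) * sum_l |z l - z l.+1| ^ 2 <= |z 0 - w| ^ 2]
    ([fejer]).

    Part (a) takes for [j] the shortest of the first [k] steps: its square is
    at most the mean of the squares, and [norm_sum_le] and [norm_sub_le] read
    the two residuals off the length of [partial_inverse u xt].
    In part (b), averaging commutes with the linear map [partial_inverse], so
    the averaged step telescopes to [(z 0 - z k) / k], of norm at most
    [2 * d0 / k]. The averaged error also telescopes and leaves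
    [|z 0 - a| ^ 2 / (2 * k)] with [a] the mean of the iterates
    ([error_sum_le]); since [a] is no further from a solution than [z 0] is,
    this is at most [2 * d0 ^ 2 / k].

    Since [d0] is an infimum, squared estimates are proved against every
    extended solution [w], with constants that do not involve [w], and then
    transferred to [d0] by [le_sqr_prod_dist]. *)

(** * Symmetric positive bilinear forms *)

Section DotProduct.
Context {R : realType} {U : lmodType R} (f : {dot U for idfun}).

Implicit Types u v : U.

Lemma dotC u v : f u v = f v u.
Proof. by rewrite hermC expr0 mul1r. Qed.

Lemma dot_ge0 u : 0 <= f u u.
Proof.
have [->|u0] := eqVneq u 0; first by rewrite linear0l.
exact/ltW/neq0_dnorm_gt0.
Qed.

Lemma dot_sqD u v : f (u + v) (u + v) = f u u + 2 * f u v + f v v.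
Proof. by rewrite !linearDl !linearDr /= [f v u]dotC; ring. Qed.

(** The parallelogram law, which replaces the triangle inequality wherever a
    bound on squared distances is wanted. *)
Lemma dot_sqB_le u v : f (u - v) (u - v) <= 2 * f u u + 2 * f v v.
Proof.
have := dot_ge0 (u + v); rewrite /= !dot_sqD !linearNr linearNl /=; lra.
Qed.

(** The decomposition of a second moment into mean and centered parts. It is
    used for averages over the [m] operators (the splitting of [H ^ m] into
    diagonal and zero-sum families) and for averages over time. *)
Lemma dot_sum_decomp n (c d : U) (p q : 'I_n -> U) :
  \sum_(i < n) p i = 0 -> \sum_(i < n) q i = 0 ->
  \sum_(i < n) f (c + p i) (d + q i) =
    n%:R * f c d + \sum_(i < n) f (p i) (q i).
Proof.
move=> p0 q0.
under eq_bigr do rewrite linearDl !linearDr.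
rewrite !big_split /= -[\sum_(i < n) f c (q i)]linear_sumr q0 linear0r.
rewrite -[\sum_(i < n) f (p i) d]linear_sumlz p0 linear0l addr0 add0r.
by rewrite sumr_const card_ord mulr_natl -linearMnr.
Qed.

End DotProduct.
Arguments dot_ge0 {R U} f u.
Arguments dot_sqB_le {R U} f u v.

(** * Inexact proximal point sequences with relative error *)

Section InexactProximalPoint.
Context {R : realType} {U : lmodType R} (f : {dot U for idfun}).
Variables (sigma : R) (z : nat -> U) (e : nat -> R).
Hypothesis error_le : forall l,
  2 * e l.+1 <= sigma ^+ 2 * f (z l - z l.+1) (z l - z l.+1).

Lemma sq_dist_step l w :
  f (z l - w) (z l - w) = f (z l.+1 - w) (z l.+1 - w) +
    2 * f (z l - z l.+1) (z l.+1 - w) + f (z l - z l.+1) (z l - z l.+1).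
Proof.
rewrite [f _ (z l.+1 - w) in X in _ + X + _]dotC -dot_sqD.
by rewrite [z l.+1 - w + _]addrC addrA subrK.
Qed.

(** Up to [b], each pairing is half the decrease of the squared distance to [a]
    minus half the squared step; the decreases telescope and the squared step
    pays for the error.
    Centering makes the constant [b] harmless; it is there to match the
    centering of both factors in the ergodic error. *)
Lemma error_sum_le k (a b : U) :
  sigma ^+ 2 <= 1 -> \sum_(l < k) (z l.+1 - a) = 0 ->
  2 * \sum_(l < k) (e l.+1 + f (z l.+1 - a) (z l - z l.+1 - b)) <=
    f (z 0%N - a) (z 0%N - a).
Proof.
move=> sigma1 sum0.
under eq_bigr do rewrite linearBr addrA.
rewrite sumrB -linear_sumlz sum0 linear0l subr0 mulr_sumr.
apply: (@le_trans _ _ (\sum_(l < k)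
    (f (z l - a) (z l - a) - f (z l.+1 - a) (z l.+1 - a)))).
  apply: ler_sum => l _; rewrite (sq_dist_step l a) /=.
  rewrite (dotC f (z l.+1 - a) (z l - _)).
  have := error_le l; have := dot_ge0 f (z l - z l.+1); nra.
rewrite -(big_mkord xpredT (fun l =>
  f (z l - a) (z l - a) - f (z l.+1 - a) (z l.+1 - a))).
rewrite (telescope_sumr_eq (fun l => - f (z l - a) (z l - a))) //.
  by rewrite opprK addrC lerBlDr lerDl dot_ge0.
by move=> i _; rewrite opprK addrC.
Qed.

Section Fejer.
Variable w : U.
Hypothesis inclusion : forall l, - e l.+1 <= f (z l - z l.+1) (z l.+1 - w).

(** The inner product with the step can be negative, but by no more than the
    error, and the squared step absorbs this up to the factor
    [1 - sigma ^+ 2]. *)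
Lemma fejer k :
  f (z k - w) (z k - w) +
    (1 - sigma ^+ 2) * \sum_(l < k) f (z l - z l.+1) (z l - z l.+1) <=
  f (z 0%N - w) (z 0%N - w).
Proof.
elim: k => [|k IH]; first by rewrite big_ord0 mulr0 addr0.
apply: le_trans IH; rewrite big_ord_recr /= (sq_dist_step k w).
have := error_le k; have := inclusion k; lra.
Qed.

Hypothesis sigma1 : sigma ^+ 2 <= 1.

Lemma fejer_sq_dist k :
  f (z k - w) (z k - w) <= f (z 0%N - w) (z 0%N - w).
Proof.
apply: le_trans (fejer k); rewrite lerDl mulr_ge0 ?subr_ge0 //.
by apply: sumr_ge0 => l _; exact: dot_ge0.
Qed.

Lemma fejer_displacement k :
  f (z 0%N - z k) (z 0%N - z k) <= 4 * f (z 0%N - w) (z 0%N - w).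
Proof.
have := dot_sqB_le f (z 0%N - w) (z k - w).
by rewrite opprB addrA subrK; have := fejer_sq_dist k; lra.
Qed.

(** The mean of points of a ball centered at [w] stays in the ball: its squared
    distance to [w] is the mean squared distance minus a variance. *)
Lemma fejer_mean_displacement k (a : U) :
  (0 < k)%N -> \sum_(l < k) (z l.+1 - a) = 0 ->
  f (z 0%N - a) (z 0%N - a) <= 4 * f (z 0%N - w) (z 0%N - w).
Proof.
move=> k0 sum0.
have mean_le : f (a - w) (a - w) <= f (z 0%N - w) (z 0%N - w).
  have := dot_sum_decomp f (a - w) (a - w) sum0 sum0.
  under eq_bigr do rewrite addrC addrA subrK.
  move=> eqn; rewrite -(ler_pM2l (_ : 0 < k%:R)) ?ltr0n //.
  apply: (@le_trans _ _ (\sum_(l < k) f (z l.+1 - w) (z l.+1 - w))).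
    rewrite eqn lerDl; apply: sumr_ge0 => l _; exact: dot_ge0.
  rewrite mulr_natl -[k in _ *+ k]card_ord -sumr_const.
  by apply: ler_sum => l _; exact: fejer_sq_dist.
have := dot_sqB_le f (z 0%N - w) (a - w).
rewrite opprB addrA subrK; lra.
Qed.

End Fejer.
End InexactProximalPoint.

(** * The product space and the partial inverse *)

Section ProductSpace.
Context {R : realType} {H : completeNormedModType R} (ip : {dot H for idfun}).
Variable m : nat.
Implicit Types p q z w : 'I_m -> H.

Let prod_ip_linear_l w : linear_for *%R ((@prod_ip R H ip m)^~ w).
Proof.
move=> a z z'; rewrite /prod_ip mulr_sumr -big_split.
by apply: eq_bigr => i _; rewrite /= linearDl linearZl_LR.
Qed.

Let prod_ip_herm z w : prod_ip ip z w = (-1) ^+ false * idfun (prod_ip ip w z).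
Proof. by rewrite mul1r; apply: eq_bigr => i _; rewrite dotC. Qed.

Let prod_ip_bilinear :
  bilinear_for *%R ( *%R : R -> R -> R) (@prod_ip R H ip m).
Proof.
split=> [|w a z z']; first exact: prod_ip_linear_l.
by rewrite !(prod_ip_herm w) /= !mul1r prod_ip_linear_l.
Qed.

Let prod_ip_gt0 z : z != 0 -> 0 < prod_ip ip z z.
Proof.
apply: contra_neqT; rewrite -leNgt => z0; apply/funext => i; apply/eqP.
have zi_le : ip (z i) (z i) <= prod_ip ip z z.
  rewrite /prod_ip (bigD1 i) //= lerDl.
  by apply: sumr_ge0 => l _; exact: dot_ge0.
apply: contraTT isT => /(neq0_dnorm_gt0 (s := ip)).
by rewrite ltNge (le_trans zi_le z0).
Qed.

(* The general facts on dot products then apply to [H ^ m] itself. *)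
HB.instance Definition _ :=
  @bilinear_isBilinear.Build R ('I_m -> H) ('I_m -> H) R
    (GRing.Scale.Law.clone _ _ ( *%R ) _)
    (GRing.Scale.Law.clone _ _ (idfun \; *%R ) _)
    (@prod_ip R H ip m) prod_ip_bilinear.
HB.instance Definition _ := @isHermitianSesquilinear.Build R ('I_m -> H)
  false idfun (@prod_ip R H ip m) prod_ip_herm.
HB.instance Definition _ := @isDotProduct.Build R ('I_m -> H)
  (@prod_ip R H ip m) prod_ip_gt0.

Lemma sqr_prod_norm z : prod_norm ip z ^+ 2 = prod_ip ip z z.
Proof. by rewrite sqr_sqrtr // dot_ge0. Qed.

Section Distance.
Variables (z : 'I_m -> H) (S : set ('I_m -> H)).
Hypothesis S0 : S !=set0.

Lemma prod_dist_ge0 : 0 <= prod_dist ip z S.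
Proof.
apply: lb_le_inf => [|_ [w Sw <-]]; last exact: sqrtr_ge0.
by case: S0 => w Sw; exists (prod_norm ip (z - w)), w.
Qed.

(** The passage from estimates against every point of [S] to the infimum. *)
Lemma le_sqr_prod_dist c :
  (forall w, S w -> c <= prod_ip ip (z - w) (z - w)) ->
  c <= prod_dist ip z S ^+ 2.
Proof.
move=> c_le; have [c0|/ltW c0] := leP 0 c; last first.
  by apply: le_trans c0 _; exact: sqr_ge0.
rewrite -(sqr_sqrtr c0) ler_sqr ?nnegrE ?sqrtr_ge0 ?prod_dist_ge0 //.
apply: lb_le_inf => [|_ [w Sw <-]]; last by rewrite ler_wsqrtr // c_le.
by case: S0 => w Sw; exists (prod_norm ip (z - w)), w.
Qed.

End Distance.

Definition average p : H := m%:R^-1 *: \sum_(i < m) p i.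

(** Since [average] is the diagonal component of a family, this is the sum of
    the diagonal component of [p] and the zero-sum component of [q]. *)
Definition partial_inverse p q : 'I_m -> H :=
  fun i => average p + (q i - average q).

Lemma average_linear a p q : average (a *: p + q) = a *: average p + average q.
Proof.
rewrite /average (eq_bigr (fun i => a *: p i + q i)) // big_split /= scalerDr.
by rewrite -scaler_sumr !scalerA mulrC.
Qed.

Lemma average0 p : \sum_(i < m) p i = 0 -> average p = 0.
Proof. by rewrite /average => ->; rewrite scaler0. Qed.

Lemma partial_inverse_linear a p p' q q' :
  partial_inverse (a *: p + p') (a *: q + q') =
  a *: partial_inverse p q + partial_inverse p' q'.
Proof.
apply/funext => i; rewrite /partial_inverse !average_linear !fctE.
by rewrite scalerDr scalerBr opprD [RHS]addrACA [X in _ + X = _]addrACA.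
Qed.

Lemma partial_inverse0 : partial_inverse 0 0 = 0.
Proof.
have avg0 : average 0 = 0 by apply: average0; rewrite big1.
by apply/funext => i; rewrite /partial_inverse avg0 add0r subr0.
Qed.

Lemma partial_inverseZ a p q :
  partial_inverse (a *: p) (a *: q) = a *: partial_inverse p q.
Proof.
by have := partial_inverse_linear a p 0 q 0; rewrite partial_inverse0 !addr0.
Qed.

Lemma partial_inverseB p p' q q' :
  partial_inverse (p - p') (q - q') =
  partial_inverse p q - partial_inverse p' q'.
Proof.
by have := partial_inverse_linear (-1) p' p q' q; rewrite !scaleN1r ![- _ + _]addrC.
Qed.

Lemma partial_inverse_sum n (p q : 'I_n -> 'I_m -> H) :
  partial_inverse (\sum_(l < n) p l) (\sum_(l < n) q l) =
  \sum_(l < n) partial_inverse (p l) (q l).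
Proof.
elim/big_rec3: _ => [|l r q' p' _ <-]; first exact: partial_inverse0.
by have := partial_inverse_linear 1 (p l) p' (q l) q'; rewrite !scale1r.
Qed.

Lemma partial_inverseD p q : partial_inverse p q + partial_inverse q p = p + q.
Proof.
apply/funext => i; rewrite !fctE /partial_inverse addrACA.
by rewrite [average p + _]addrC addrACA !subrKC addrC.
Qed.

Hypothesis m_gt0 : (0 < m)%N.

Lemma average_cst (c : H) : average (fun=> c) = c.
Proof.
by rewrite /average sumr_const card_ord -[c *+ m]scaler_nat scalerA mulVf ?scale1r
  ?pnatr_eq0 -?lt0n.
Qed.

Lemma sum_sub_average p :
  \sum_(i < m) (p i - average p) = 0.
Proof.
rewrite sumrB sumr_const card_ord -[_ *+ m]scaler_nat /average scalerA mulfV.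
  by rewrite scale1r subrr.
by rewrite pnatr_eq0 -lt0n.
Qed.

(** The diagonal and zero-sum components are orthogonal, so the pairing splits
    into two blocks, and the swap merely exchanges the factors in one of them. *)
Lemma prod_ip_partial_inverse p q :
  prod_ip ip (partial_inverse p q) (partial_inverse q p) = prod_ip ip p q.
Proof.
have sub_avg := sum_sub_average.
rewrite /prod_ip (dot_sum_decomp ip (average p) (average q)) //.
under [in RHS]eq_bigr do rewrite -[p _](subrK (average p)) addrC
  -[q _](subrK (average q)) [q _ - _ + _]addrC.
rewrite dot_sum_decomp //; congr (_ + _).
by apply: eq_bigr => i _; rewrite dotC.
Qed.

Lemma sq_partial_inverse p q :
  prod_ip ip (partial_inverse p q) (partial_inverse p q) =
  m%:R * ip (average p) (average p) +
  \sum_(i < m) ip (q i - average q) (q i - average q).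
Proof. by apply: dot_sum_decomp; exact: sum_sub_average. Qed.

Hypothesis ip_norm : induces_norm ip.

Lemma sqr_norm (v : H) : `|v| ^+ 2 = ip v v.
Proof. by rewrite ip_norm sqr_sqrtr // dot_ge0. Qed.

(** Together with [norm_sub_le], this recovers from a single norm in [H ^ m] the
    two residuals: how far the operator values are from summing to zero and how
    far the points are from agreeing. *)
Lemma norm_sum_le p q :
  `|\sum_(i < m) p i| <= Num.sqrt m%:R * prod_norm ip (partial_inverse p q).
Proof.
rewrite -ler_sqr ?nnegrE ?mulr_ge0 ?sqrtr_ge0 //.
rewrite exprMn sqr_prod_norm sqr_sqrtr ?ler0n // sq_partial_inverse.
have -> : \sum_(i < m) p i = m%:R *: average p.
  by rewrite scalerA mulfV ?scale1r // pnatr_eq0 -lt0n.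
rewrite normrZ exprMn sqr_norm ger0_norm ?ler0n // expr2 -mulrA.
rewrite ler_wpM2l ?ler0n // lerDl.
by apply: sumr_ge0 => i _; exact: dot_ge0.
Qed.

Lemma norm_sub_average_le p q i :
  `|q i - average q| <= prod_norm ip (partial_inverse p q).
Proof.
rewrite -ler_sqr ?nnegrE ?sqrtr_ge0 // sqr_prod_norm sqr_norm.
rewrite sq_partial_inverse (bigD1 i) //= [_ + (_ + _)]addrCA lerDl.
rewrite addr_ge0 ?mulr_ge0 ?ler0n ?dot_ge0 //.
by apply: sumr_ge0 => l _; exact: dot_ge0.
Qed.

Lemma norm_sub_le p q i l :
  `|q i - q l| <= 2 * prod_norm ip (partial_inverse p q).
Proof.
have -> : q i - q l = (q i - average q) - (q l - average q).
  by rewrite opprB addrA subrK.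
apply: le_trans (ler_normB _ _) _; rewrite mulr_natl mulr2n.
by apply: lerD; exact: norm_sub_average_le.
Qed.

End ProductSpace.

(** * Ergodic means in the enlargement of one operator *)

Section ErgodicMean.
Context {R : realType} {H : completeNormedModType R} (ip : {dot H for idfun}).
Variables (k : nat) (k_gt0 : (0 < k)%N).

Lemma sum_from1 (V : nmodType) (F : nat -> V) :
  \sum_(1 <= l < k.+1) F l = \sum_(l < k) F l.+1.
Proof. by rewrite big_add1 big_mkord. Qed.

Lemma sum_sub_ergodic_mean (p : nat -> H) :
  \sum_(l < k) (p l.+1 - ergodic_mean p k) = 0.
Proof.
rewrite sumrB sumr_const card_ord -[_ *+ k]scaler_nat /ergodic_mean sum_from1.
by rewrite scalerA mulfV ?scale1r ?subrr // pnatr_eq0 -lt0n.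
Qed.

(** The transportation formula: the mean of the pairings of a point of the
    graph with the pairs [(xt l, u l)] is its pairing with the mean pair plus the
    covariance of [xt] and [u], which is the extra term of the ergodic error. *)
Lemma ergodic_enlargement (T : H -> set H) (xt u : nat -> H) (eps : nat -> R) :
  (forall l, enlargement ip T (eps l.+1) (xt l.+1) (u l.+1)) ->
  enlargement ip T (ergodic_error ip xt u eps k)
    (ergodic_mean xt k) (ergodic_mean u k).
Proof.
move=> incl x' v' Tx'v'; rewrite /ergodic_error sum_from1.
set a := ergodic_mean xt k; set b := ergodic_mean u k.
have k0 : 0 < k%:R :> R by rewrite ltr0n.
rewrite -mulrN ler_pdivrMl // big_split /= opprD lerBlDr.
have neg0 (p : nat -> H) : \sum_(l < k) (ergodic_mean p k - p l.+1) = 0.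
  apply: oppr_inj; rewrite -sumrN oppr0 -[RHS](sum_sub_ergodic_mean p).
  by apply: eq_bigr => l _; rewrite opprB.
have := dot_sum_decomp ip (v' - b) (x' - a) (neg0 u) (neg0 xt).
rewrite (eq_bigr (fun l : 'I_k => ip (v' - u l.+1) (x' - xt l.+1))); last first.
  by move=> l _; rewrite !subrKA.
rewrite [X in _ = _ + X](eq_bigr (fun l : 'I_k =>
    ip (xt l.+1 - a) (u l.+1 - b))); last first.
  by move=> l _; rewrite dotC -[a - _]opprB -[b - _]opprB linearNr linearNl opprK.
move=> <-; rewrite -sumrN; apply: ler_sum => l _; exact: incl.
Qed.

End ErgodicMean.

(** * The splitting method as a proximal point method *)

Section Splitting.
Context {R : realType} {H : completeNormedModType R} (ip : {dot H for idfun}).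
Hypothesis ip_norm : induces_norm ip.
Variables (m : nat) (m_gt0 : (0 < m)%N) (T : 'I_m -> H -> set H) (sigma : R).
Variables (x : nat -> H) (y xt u : 'I_m -> nat -> H) (eps : 'I_m -> nat -> R).
Hypothesis alg : inexact_splitting ip T sigma x y xt u eps.

Let z k : 'I_m -> H := fun i => x k + y i k.
Let err k := \sum_(i < m) eps i k.

Lemma splitting_sum_y k : \sum_(i < m) y i k = 0.
Proof.
case: k => [|k]; first exact: (splitting_y0 alg).
rewrite (eq_bigr (fun i => u i k.+1 - average (u^~ k.+1))).
  exact: sum_sub_average.
by move=> i _; exact: (splitting_yE alg).
Qed.

Lemma splitting_iterate k :
  z k.+1 = partial_inverse (xt^~ k.+1) (u^~ k.+1).
Proof.
apply/funext => i; rewrite /z (splitting_xE alg) (splitting_yE alg).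
by [].
Qed.

(** Both sides of the swap add up to [xt + u], which is [z k]. *)
Lemma splitting_step k :
  z k - z k.+1 = partial_inverse (u^~ k.+1) (xt^~ k.+1).
Proof.
apply/eqP; rewrite subr_eq splitting_iterate partial_inverseD; apply/eqP.
by apply/funext => i; rewrite !fctE (splitting_uE alg) subrK.
Qed.

(** The deviations [xt i - x k] and the step have the same zero-sum component,
    and opposite diagonal components because the [y i k] sum to zero. This
    equality is what makes the errors relative to the step of [z]. *)
Lemma splitting_step_sq k :
  prod_ip ip (z k - z k.+1) (z k - z k.+1) =
  \sum_(i < m) ip (xt i k.+1 - x k) (xt i k.+1 - x k).
Proof.
have avg_u : average (u^~ k.+1) = x k - average (xt^~ k.+1).
  have -> : u^~ k.+1 = (-1) *: (xt^~ k.+1) + (1 *: (fun=> x k) + y^~ k).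
    by apply/funext => i; rewrite scale1r scaleN1r addrC !fctE (splitting_uE alg).
  rewrite !average_linear (average_cst m_gt0) (average0 (splitting_sum_y k)).
  by rewrite addr0 scale1r scaleN1r addrC.
rewrite splitting_step (sq_partial_inverse _ m_gt0) avg_u.
have sub0 := sum_sub_average m_gt0 (xt^~ k.+1).
rewrite -opprB linearNr linearNl opprK -(dot_sum_decomp _ _ _ sub0 sub0).
by apply: eq_bigr => i _; rewrite addrC subrKA.
Qed.

Lemma splitting_error_le k :
  2 * \sum_(i < m) eps i k.+1 <=
  sigma ^+ 2 * prod_ip ip (z k - z k.+1) (z k - z k.+1).
Proof.
rewrite splitting_step_sq !mulr_sumr; apply: ler_sum => i _.
have := splitting_error alg i k; rewrite (sqr_norm ip_norm); lra.
Qed.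

(** An extended solution is [partial_inverse] of the constant family of its
    solution point and of its multipliers; swapping the two gives 0, that is, a
    zero of the partial inverse operator. So the pairing is that of two points
    of the swapped graph. *)
Lemma splitting_inclusion w (Sw : extended_solution_set T w) k :
  - \sum_(i < m) eps i k.+1 <= prod_ip ip (z k - z k.+1) (z k.+1 - w).
Proof.
case: Sw => xs [us [Tus us0 wE]].
have avg_us := average0 us0.
have -> : w = partial_inverse (fun=> xs) us.
  apply/funext => i.
  by rewrite wE /partial_inverse (average_cst m_gt0) avg_us subr0.
have us_xs0 : partial_inverse us (fun=> xs) = 0.
  apply/funext => i.
  by rewrite /partial_inverse avg_us (average_cst m_gt0) add0r subrr.
rewrite splitting_step -[X in prod_ip ip X]subr0 -us_xs0.
rewrite splitting_iterate -!partial_inverseB (prod_ip_partial_inverse _ m_gt0).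
rewrite -sumrN; apply: ler_sum => i _.
have := splitting_incl alg k (Tus i).
by rewrite -[us i - _]opprB -[xs - _]opprB linearNr linearNl opprK.
Qed.

Variable (sigma_ge0 : 0 <= sigma) (sigma_lt1 : sigma < 1).
Hypothesis sol_nonempty : extended_solution_set T !=set0.

Let d0 := prod_dist ip (z 0%N) (extended_solution_set T).

Let sigma_sq_le1 : sigma ^+ 2 <= 1.
Proof. by rewrite expr_le1 // ltW. Qed.

Lemma sum_step_sq_le k :
  (1 - sigma ^+ 2) *
    \sum_(l < k) prod_ip ip (z l - z l.+1) (z l - z l.+1) <= d0 ^+ 2.
Proof.
apply: le_sqr_prod_dist => // w Sw.
apply: le_trans (fejer (e := err) splitting_error_le (splitting_inclusion Sw) k).
by rewrite lerDr dot_ge0.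
Qed.

Lemma displacement_le k : prod_norm ip (z 0%N - z k) <= 2 * d0.
Proof.
have d0_ge0 : 0 <= d0 by exact: prod_dist_ge0.
rewrite -ler_sqr ?nnegrE ?sqrtr_ge0 ?mulr_ge0 // sqr_prod_norm exprMn.
rewrite -ler_pdivrMl ?exprn_gt0 //.
apply: le_sqr_prod_dist => // w Sw; rewrite ler_pdivrMl ?exprn_gt0 //.
have := fejer_displacement (e := err) splitting_error_le (splitting_inclusion Sw)
  sigma_sq_le1 k.
by have -> : 2 ^+ 2 = 4 :> R by ring.
Qed.

Lemma sqr_mean_displacement_le k (a : 'I_m -> H) :
  (0 < k)%N -> \sum_(l < k) (z l.+1 - a) = 0 ->
  prod_ip ip (z 0%N - a) (z 0%N - a) <= 4 * d0 ^+ 2.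
Proof.
move=> k_gt0 sum0; rewrite -ler_pdivrMl //.
apply: le_sqr_prod_dist => // w Sw; rewrite ler_pdivrMl //.
exact: (fejer_mean_displacement (e := err) splitting_error_le
  (splitting_inclusion Sw) sigma_sq_le1 k_gt0 sum0).
Qed.

Section Ergodic.
Variables (k : nat) (k_gt0 : (0 < k)%N).

Let xta i := ergodic_mean (xt i) k.
Let ua i := ergodic_mean (u i) k.

Lemma ergodic_mean_family (p : 'I_m -> nat -> H) :
  (fun i => ergodic_mean (p i) k) = k%:R^-1 *: \sum_(l < k) (p^~ l.+1).
Proof.
by apply/funext => i; rewrite /ergodic_mean sum_from1 !fctE fct_sumE.
Qed.

(** Averaging commutes with the linear swap, so the steps telescope. *)
Lemma partial_inverse_ergodic_mean :
  partial_inverse ua xta = k%:R^-1 *: (z 0%N - z k).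
Proof.
rewrite /ua /xta !ergodic_mean_family partial_inverseZ partial_inverse_sum.
congr (_ *: _); under eq_bigr do rewrite -splitting_step.
rewrite -(big_mkord xpredT (fun l => z l - z l.+1)).
rewrite (telescope_sumr_eq (fun l => - z l)) //.
  by rewrite opprK addrC.
by move=> i _; rewrite opprK addrC.
Qed.

Lemma prod_norm_ergodic_le :
  prod_norm ip (partial_inverse ua xta) <= 2 * d0 / k%:R.
Proof.
have k0 : 0 <= k%:R^-1 :> R by rewrite invr_ge0 ler0n.
rewrite partial_inverse_ergodic_mean /prod_norm linearZl_LR linearZr_LR /=.
rewrite mulrA -expr2 sqrtrM ?sqr_ge0 // sqrtr_sqr ger0_norm // mulrC.
by rewrite ler_wpM2r // displacement_le.
Qed.

(** The covariance terms summed over the operators form the covariance of the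
    iterates and the steps in [H ^ m], because the swap preserves the pairing. *)
Lemma sum_ergodic_error_le :
  \sum_(i < m) ergodic_error ip (xt i) (u i) (eps i) k <= 2 * d0 ^+ 2 / k%:R.
Proof.
have k0 : 0 < k%:R :> R by rewrite ltr0n.
rewrite -mulr_sumr mulrC ler_pdivrMr //.
rewrite divfK ?gt_eqF //.
under eq_bigr do rewrite sum_from1.
rewrite exchange_big /=.
set a := partial_inverse xta ua; set b := partial_inverse ua xta.
have sum0 : \sum_(l < k) (z l.+1 - a) = 0.
  under eq_bigr do rewrite splitting_iterate -partial_inverseB.
  rewrite -partial_inverse_sum -[RHS](partial_inverse0 m).
  congr (partial_inverse _ _); apply/funext => i; rewrite fct_sumE;
    exact: sum_sub_ergodic_mean.
rewrite -(ler_pM2l (ltr0n _ 2)) mulrA -natrM.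
apply: le_trans (sqr_mean_displacement_le k_gt0 sum0).
have := error_sum_le (e := err) splitting_error_le b sigma_sq_le1 sum0.
apply: le_trans; rewrite ler_pM2l // le_eqVlt; apply/orP; left; apply/eqP.
apply: eq_bigr => l _; rewrite big_split /=; congr (_ + _).
rewrite splitting_step splitting_iterate -!partial_inverseB.
by rewrite (prod_ip_partial_inverse _ m_gt0).
Qed.

End Ergodic.

(** The square of the shortest step is at most the mean of the squares; its index
    does not depend on any extended solution. *)
Lemma exists_small_step k (k_gt0 : (0 < k)%N) : exists2 l, (l < k)%N &
  (1 - sigma ^+ 2) * prod_ip ip (z l - z l.+1) (z l - z l.+1) <= d0 ^+ 2 / k%:R.
Proof.
pose s l := prod_ip ip (z l - z l.+1) (z l - z l.+1).
have [l _ l_min] := @arg_minP _ _ _ (Ordinal k_gt0) xpredT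
  (fun l : 'I_k => s l) isT.
exists l => //; rewrite ler_pdivlMr ?ltr0n // -mulrA.
apply: le_trans (sum_step_sq_le k); rewrite ler_wpM2l ?subr_ge0 //.
rewrite mulr_natr -[k in _ *+ k]card_ord -sumr_const.
by apply: ler_sum => l' _; exact: l_min.
Qed.

End Splitting.

(** * Pointwise and ergodic iteration complexity *)

Theorem theorem4p1 (R : realType) (H : completeNormedModType R)
    (ip : {dot H for idfun}) (ip_norm : induces_norm ip)
    (m : nat) (m_ge2 : (2 <= m)%N) (T : 'I_m -> H -> set H)
    (T_max : forall i, maximal_monotone ip (T i))
    (sol_nonempty : extended_solution_set T !=set0)
    (sigma : R) (sigma_ge0 : 0 <= sigma) (sigma_lt1 : sigma < 1)
    (x : nat -> H) (y xt u : 'I_m -> nat -> H) (eps : 'I_m -> nat -> R)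
    (alg : inexact_splitting ip T sigma x y xt u eps) :
  let xta i k := ergodic_mean (xt i) k in
  let ua i k := ergodic_mean (u i) k in
  let epsa i k := ergodic_error ip (xt i) (u i) (eps i) k in
  let d0 := prod_dist ip (fun i => x 0%N + y i 0%N) (extended_solution_set T) in
  (forall k : nat, (1 <= k)%N ->
     exists j : nat, (1 <= j <= k)%N /\
     [/\ forall i, enlargement ip (T i) (eps i j) (xt i j) (u i j),
         `|\sum_(i < m) u i j| <=
           Num.sqrt m%:R * d0 / Num.sqrt k%:R
           * Num.sqrt ((1 + sigma) / (1 - sigma)),
         forall i l, `|xt i j - xt l j| <=
           2 * d0 / Num.sqrt k%:R * Num.sqrt ((1 + sigma) / (1 - sigma))
       & \sum_(i < m) eps i j <=
           sigma ^+ 2 * d0 ^+ 2 / (2 * (1 - sigma ^+ 2) * k%:R)]) /\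
  (forall k : nat, (1 <= k)%N ->
     [/\ forall i, enlargement ip (T i) (epsa i k) (xta i k) (ua i k),
         `|\sum_(i < m) ua i k| <= 2 * Num.sqrt m%:R * d0 / k%:R,
         forall i l, `|xta i k - xta l k| <= 4 * d0 / k%:R
       & \sum_(i < m) epsa i k <=
           2 * (1 + sigma / Num.sqrt (1 - sigma ^+ 2)) * d0 ^+ 2 / k%:R]).
Proof.
move=> xta ua epsa d0; have m_gt0 : (0 < m)%N by exact: ltnW.
have d0_ge0 : 0 <= d0 by exact: prod_dist_ge0.
have s2_lt1 : 0 < 1 - sigma ^+ 2 by rewrite subr_gt0 expr_lt1.
have norm_sum := norm_sum_le m_gt0 ip_norm.
have norm_sub := norm_sub_le m_gt0 ip_norm.
split=> k k_gt0; have k0 : 0 < k%:R :> R by rewrite ltr0n.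
- have [l l_lt_k] := exists_small_step ip_norm m_gt0 alg sigma_ge0 sigma_lt1
    sol_nonempty k_gt0.
  rewrite -/d0 => step_le; exists l.+1; split=> //.
  have err_le := splitting_error_le ip_norm m_gt0 alg l.
  rewrite (splitting_step alg) in step_le err_le.
  set N := prod_norm ip (partial_inverse (u^~ l.+1) (xt^~ l.+1)).
  rewrite -sqr_prod_norm -/N in step_le err_le.
  have N_le : N <= d0 / Num.sqrt k%:R * Num.sqrt ((1 + sigma) / (1 - sigma)).
    have ratio_ge0 : 0 <= (1 + sigma) / (1 - sigma) by rewrite divr_ge0; lra.
    rewrite -ler_sqr ?nnegrE ?mulr_ge0 ?invr_ge0 ?sqrtr_ge0 //.
    rewrite !exprMn exprVn (sqr_sqrtr ratio_ge0) (sqr_sqrtr (ltW k0)).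
    rewrite mulrA ler_pdivlMr ?subr_gt0 //.
    have D0 : 0 <= d0 ^+ 2 / k%:R by rewrite divr_ge0 ?sqr_ge0 ?ler0n.
    (* With [D = d0 ^+ 2 / k], the chain is [(1 - sigma) * N ^+ 2
       <= (1 - sigma ^+ 2) * N ^+ 2 <= D <= D * (1 + sigma)]. *)
    have sN0 : 0 <= sigma * (1 - sigma) * N ^+ 2.
      by rewrite mulr_ge0 ?sqr_ge0 // mulr_ge0 // subr_ge0 ltW.
    have sD0 := mulr_ge0 sigma_ge0 D0.
    move: (d0 ^+ 2 / _) step_le D0 sD0 => D; lra.
  split.
  + by move=> i; exact: (splitting_incl alg).
  + apply: le_trans (norm_sum _ (xt^~ l.+1)) _; rewrite -!mulrA ler_wpM2l ?sqrtr_ge0 //.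
    by rewrite mulrA.
  + move=> i i'; apply: le_trans (norm_sub (u^~ l.+1) (xt^~ l.+1) i i') _.
    by rewrite -!mulrA ler_wpM2l // mulrA.
  + have -> : sigma ^+ 2 * d0 ^+ 2 / (2 * (1 - sigma ^+ 2) * k%:R) =
      sigma ^+ 2 * (d0 ^+ 2 / k%:R / (1 - sigma ^+ 2)) / 2.
      by field; rewrite !gt_eqF.
    rewrite ler_pdivlMr // mulrC; apply: le_trans err_le _.
    by rewrite ler_wpM2l ?sqr_ge0 // ler_pdivlMr // mulrC.
- have N_le := prod_norm_ergodic_le ip_norm m_gt0 alg sigma_ge0 sigma_lt1
    sol_nonempty k.
  rewrite -/d0 in N_le.
  split.
  + by move=> i; apply: ergodic_enlargement => // l; exact: (splitting_incl alg).
  + apply: le_trans (norm_sum _ (xta^~ k)) _.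
    have -> : 2 * Num.sqrt m%:R * d0 / k%:R = Num.sqrt m%:R * (2 * d0 / k%:R).
      by ring.
    by apply: ler_wpM2l; rewrite ?sqrtr_ge0.
  + move=> i i'; apply: le_trans (norm_sub (ua^~ k) (xta^~ k) i i') _.
    have -> : 4 * d0 / k%:R = 2 * (2 * d0 / k%:R) by ring.
    exact: ler_wpM2l.
  + apply: le_trans (sum_ergodic_error_le ip_norm m_gt0 alg sigma_ge0 sigma_lt1
      sol_nonempty k_gt0) _.
    rewrite -/d0 ler_wpM2r ?invr_ge0 ?ler0n // ler_wpM2r ?sqr_ge0 //.
    by rewrite ler_peMr // lerDl divr_ge0 ?sqrtr_ge0.
Qed.
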